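(* Let $(\mathrm{X},\Sigma,\mu)$ be a measure space. For each $p\in[1,\infty)$, the space $\Lambda_p(\mathrm{X})$, endowed with the $\mathrm{F}$-norm $\|\cdot\|_{\alpha_p}$, is an $\mathrm{F}$-space with the topology of asymptotic $L_p$-convergence (that is, $\Lambda_p(\mathrm{X})$ with the metric $\mathrm{d}_{\alpha_p}(f,g)=\|f-g\|_{\alpha_p}$ is a complete metrizable topological vector space, and a sequence in $\Lambda_p(\mathrm{X})$ converges in this metric to $f \in \Lambda_p(\mathrm{X})$ if and only if it asymptotically $L_p$-converges to $f$). Moreover, if $\mu(\mathrm{X})<\infty$, then $\Lambda_p(\mathrm{X})$ coincides with $L_0(\mathrm{X})$, equipped with the topology of (local) convergence in measure; that is, $\Lambda_p(\mathrm{X})=L_0(\mathrm{X})$ as sets and the topology induced by $\|\cdot\|_{\alpha_p}$ is the topology of convergence in measure, which is also the topology of local convergence in measure.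
   Context: $L_0(\mathrm{X})$ is the space of real-valued measurable functions on $\mathrm{X}$, identified $\mu$-a.e.; $L_p(\mathrm{X})$ is the Lebesgue space of measurable $f$ with $\|f\|_p^p=\int_{\mathrm{X}}|f|^p\,d\mu<\infty$. For $p\in[1,\infty)$, $$\Lambda_p(\mathrm{X})=\{f\in L_0(\mathrm{X}) : \forall\,\delta>0\ \exists\,E_\delta\in\Sigma \text{ with } \mu(E_\delta)<\delta \text{ and } f\chi_{E_\delta^c}\in L_p(\mathrm{X})\},$$ and $\|f\|_{\alpha_p}=\|\min(|f|,1)\|_p$. An $\mathrm{F}$-norm on a real vector space $V$ is a functional $\|\cdot\|:V\to\mathbb{R}$ with: $\|f\|\ge 0$ for all $f$, and $\|f\|>0$ for $f\ne 0$; $\|\lambda f\|\le\|f\|$ for all $\lambda \in \mathbb{R}$ with $|\lambda|\le1$ and all $f$; $\lim_{\lambda\to0}\|\lambda f\|=0$ for all $f$; $\|f+g\|\le\|f\|+\|g\|$ for all $f,g$. An $\mathrm{F}$-space is a metrizable topological vector space which is complete with respect to a translation-invariant metric. A sequence of measurable functions $(f_n)$ asymptotically $L_p$-converges ($\alpha_p$-converges) to a measurable function $f$ if there is a sequence of measurable sets $(B_n)$ with $\mu(B_n^c)\to0$ and $\int_{B_n}|f_n-f|^p\,d\mu\to0$ as $n\to\infty$. The sequence $(f_n)$ converges in measure to $f$ if $\mu(|f_n-f|>\delta)\to0$ for each $\delta>0$; it converges locally in measure to $f$ if it converges in measure to $f$ on every measurable subset of finite measure. The topology of convergence in measure on $L_0(\mathrm{X})$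 is the one induced by the metric $\mathrm{d}_\mu(f,g)=\|f-g\|_\mu$, where $\|f\|_\mu=\min\left(\inf_{\delta>0}\{\mu(|f|>\delta)+\delta\},1\right)$. The topology of local convergence in measure on $L_0(\mathrm{X})$ is the one generated by the $\mathrm{F}$-seminorms $f\mapsto\int_F\min(|f|,1)\,d\mu$, for $F\in\Sigma$ with $\mu(F)<\infty$. *)

(* Defs.v *)
From HB Require Import structures.
From mathcomp Require Import all_boot all_order all_algebra.
From mathcomp Require Import all_classical all_reals all_analysis.
From mathcomp Require Import measurable_realfun.

Set Implicit Arguments.
Unset Strict Implicit.
Unset Printing Implicit Defensive.

Import Order.TTheory GRing.Theory Num.Theory.
Import numFieldNormedType.Exports.
Local Open Scope classical_set_scope.
Local Open Scope ring_scope.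

Section L0_lmodule.
Context d (T : measurableType d) (R : realType).
Variable mu : {measure set T -> \bar R}.
Local Open Scope quotient_scope.

(* Measurable functions modulo a.e. equality; a class is applied to points
   through a chosen representative, so pointwise identities between classes
   hold only a.e. *)
Definition L0 : Type := {mfun_ mu, T >-> R}.

HB.instance Definition _ := Choice.on L0.
HB.instance Definition _ := EqQuotient.on L0.

Definition L0_fun (f : L0) : T -> R := repr f.
Coercion L0_fun : L0 >-> Funclass.

Implicit Types (f g h : L0) (u v : {mfun T >-> R}) (a b : R).

Lemma measurable_L0 f : measurable_fun [set: T] f.
Proof. by rewrite /L0_fun. Qed.

Lemma L0_piP u v : \pi_L0 u = \pi_L0 v <-> \forall x \ae mu, u x = v x.
Proof.
split=> [/eqmodP/asboolP|uv].
  by apply: filterS => x; exact.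
by apply/eqmodP/asboolP; apply: filterS uv => x + _.
Qed.

Lemma L0_piE u : \forall x \ae mu, (\pi_L0 u : L0) x = u x.
Proof. by apply/L0_piP; rewrite reprK. Qed.

Lemma L0P f g : f = g <-> \forall x \ae mu, f x = g x.
Proof. by rewrite -L0_piP !reprK. Qed.

Definition L0_zero : L0 := \pi_L0 (0 : {mfun T >-> R}).
Definition L0_opp f : L0 := \pi_L0 (- (repr f : {mfun T >-> R})).
Definition L0_add f g : L0 := \pi_L0 ((repr f : {mfun T >-> R}) + repr g).
Definition L0_scale a f : L0 := \pi_L0 (a *: (repr f : {mfun T >-> R})).

Let zeroE : \forall x \ae mu, L0_zero x = 0.
Proof. exact: L0_piE. Qed.

Let oppE f : \forall x \ae mu, L0_opp f x = - f x.
Proof. exact: L0_piE. Qed.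

Let addE f g : \forall x \ae mu, L0_add f g x = f x + g x.
Proof. exact: L0_piE. Qed.

Let scaleE a f : \forall x \ae mu, L0_scale a f x = a * f x.
Proof. exact: L0_piE. Qed.

Let L0_addA : associative L0_add.
Proof.
move=> f g h; apply/L0P.
near=> x; have /[!addrA] := erefl (f x + (g x + h x)).
rewrite (near (addE f (L0_add g h)) x)// (near (addE g h) x)//.
by rewrite (near (addE (L0_add f g) h) x)// (near (addE f g) x)// addrA.
Unshelve. all: by end_near. Qed.

Let L0_addC : commutative L0_add.
Proof.
move=> f g; apply/L0P; near=> x.
by rewrite (near (addE f g) x)// (near (addE g f) x)// addrC.
Unshelve. all: by end_near. Qed.

Let L0_add0 : left_id L0_zero L0_add.
Proof.
move=> f; apply/L0P; near=> x.
by rewrite (near (addE L0_zero f) x)// (near zeroE x)// add0r.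
Unshelve. all: by end_near. Qed.

Let L0_addN : left_inverse L0_zero L0_opp L0_add.
Proof.
move=> f; apply/L0P; near=> x.
rewrite (near (addE (L0_opp f) f) x)// (near zeroE x)//.
by rewrite (near (oppE f) x)// addNr.
Unshelve. all: by end_near. Qed.

HB.instance Definition _ :=
  GRing.isZmodule.Build L0 L0_addA L0_addC L0_add0 L0_addN.

Lemma L0_0E : \forall x \ae mu, (0 : L0) x = 0.
Proof. exact: zeroE. Qed.

Lemma L0_NE f : \forall x \ae mu, (- f : L0) x = - f x.
Proof. exact: oppE. Qed.

Lemma L0_DE f g : \forall x \ae mu, (f + g : L0) x = f x + g x.
Proof. exact: addE. Qed.

Lemma L0_BE f g : \forall x \ae mu, (f - g : L0) x = f x - g x.
Proof.
near=> x.
by rewrite (near (L0_DE f (- g)) x)// (near (L0_NE g) x).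
Unshelve. all: by end_near. Qed.

Let L0_scaleA a b f : L0_scale a (L0_scale b f) = L0_scale (a * b) f.
Proof.
apply/L0P; near=> x.
rewrite (near (scaleE a (L0_scale b f)) x)// (near (scaleE b f) x)//.
by rewrite (near (scaleE (a * b) f) x)// mulrA.
Unshelve. all: by end_near. Qed.

Let L0_scale1 : left_id 1 L0_scale.
Proof.
move=> f; apply/L0P; near=> x.
by rewrite (near (scaleE 1 f) x)// mul1r.
Unshelve. all: by end_near. Qed.

Let L0_scaleDr : right_distributive L0_scale +%R.
Proof.
move=> a f g; apply/L0P; near=> x.
rewrite (near (scaleE a (f + g)) x)// (near (L0_DE f g) x)//.
rewrite (near (L0_DE (L0_scale a f) (L0_scale a g)) x)//.
by rewrite (near (scaleE a f) x)// (near (scaleE a g) x)// mulrDr.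
Unshelve. all: by end_near. Qed.

Let L0_scaleDl f : {morph L0_scale^~ f : a b / a + b}.
Proof.
move=> a b; apply/L0P; near=> x.
rewrite (near (scaleE (a + b) f) x)//.
rewrite (near (L0_DE (L0_scale a f) (L0_scale b f)) x)//.
by rewrite (near (scaleE a f) x)// (near (scaleE b f) x)// mulrDl.
Unshelve. all: by end_near. Qed.

HB.instance Definition _ := GRing.Zmodule_isLmodule.Build R L0
  L0_scaleA L0_scale1 L0_scaleDr L0_scaleDl.

Lemma L0_ZE a f : \forall x \ae mu, (a *: f : L0) x = a * f x.
Proof. exact: scaleE. Qed.

End L0_lmodule.

Arguments L0_0E {d T R} mu.

Section Lambda.
Context d (T : measurableType d) (R : realType).
Variables (mu : {measure set T -> \bar R}) (p : R).

Definition Lambda : set (L0 mu) := [set f | forall delta : R, 0 < delta ->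
  exists E : set T, [/\ measurable E, (mu E < delta%:E)%E &
    (fun x => f x * \1_(~` E) x) \in Lfun mu p%:E]].

Definition in_Lambda : {pred L0 mu} := mem Lambda.

(* Extended-real valued on all of L0 *)
Definition alpha_norm (f : L0 mu) : \bar R :=
  'N[mu]_p%:E[EFin \o (fun x => Num.min `|f x| 1)%R]%E.

Definition alpha_cvg (f_ : (T -> R)^nat) (f : T -> R) : Prop :=
  exists B : (set T)^nat, [/\ forall n, measurable (B n),
    mu (~` B n) @[n --> \oo] --> 0%E &
    (\int[mu]_(x in B n) (`|f_ n x - f x| `^ p)%:E)%E @[n --> \oo] --> 0%E].

Hypothesis p1 : 1 <= p.

Let mN (w : T -> R) : measurable_fun setT w ->
  measurable_fun setT (fun x => `|(EFin \o w) x| `^ p)%E.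
Proof.
move=> mw; apply: (@measurableT_comp _ _ _ _ _ _ (fun x => x `^ p)%E) => //.
  exact: measurable_poweR.
by apply: measurableT_comp => //; exact/measurable_EFinP.
Qed.

Let Lfun_ae (u v : T -> R) : measurable_fun setT v ->
  (\forall x \ae mu, u x = v x) -> u \in Lfun mu p%:E -> v \in Lfun mu p%:E.
Proof.
move=> mv uv /andP[/[!inE]/= mu_ fu].
apply/andP; split; rewrite inE/=; first exact: mv.
move: fu; rewrite /finite_norm unlock.
rewrite (@ae_eq_integral _ _ _ _ _ (fun x => `|(EFin \o v) x| `^ p)%E)//.
- exact: mN.
- exact: mN.
- by apply: filterS uv => x /= -> _.
Qed.

Lemma Lambda_submod : submod_closed in_Lambda.
Proof.
have p1E : (1 <= p%:E)%E by rewrite lee_fin.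
have mI (f : L0 mu) (E : set T) : measurable E ->
    measurable_fun setT (fun x => f x * \1_(~` E) x).
  move=> mE; apply: measurable_funM; first exact: measurable_L0.
  by apply: measurable_indic; exact: measurableC.
split.
  apply/mem_set => delta delta0; exists set0; split => //.
    by rewrite measure0 lte_fin.
  apply: (@Lfun_ae 0); first exact: mI.
    by apply: filterS (L0_0E mu) => x ->; rewrite mul0r.
  exact: rpred0.
move=> a f g /set_mem fL /set_mem gL; apply/mem_set => delta delta0.
have [A [mA muA fA]] := fL _ (divr_gt0 delta0 (ltr0n _ 2)).
have [B [mB muB gB]] := gL _ (divr_gt0 delta0 (ltr0n _ 2)).
have mAB : measurable (A `|` B) by exact: measurableU.
have sub (h : L0 mu) (E F : set T) : measurable E -> measurable F ->
    E `<=` F -> (fun x => h x * \1_(~` E) x) \in Lfun mu p%:E ->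
    (fun x => h x * \1_(~` F) x) \in Lfun mu p%:E.
  move=> mE mF EF /andP[_ /[!inE]/= hE]; apply/andP.
  split; rewrite inE/=; first exact: mI.
  apply: le_lt_trans hE; rewrite Lnorm.unlock; apply: gt0_ler_poweR.
  - by rewrite invr_ge0 (le_trans ler01).
  - by rewrite in_itv/= leey integral_ge0// => x _; exact: poweR_ge0.
  - by rewrite in_itv/= leey integral_ge0// => x _; exact: poweR_ge0.
  apply: ge0_le_integral => //.
  - by move=> x _; exact: poweR_ge0.
  - exact/mN/mI.
  - exact/mN/mI.
  move=> x _ /=; rewrite !lee_fin ge0_ler_powR ?nnegrE// ?(le_trans ler01)//.
  rewrite !normrM ler_wpM2l// !ger0_norm// !indicE ler_nat.
  have [|//] := boolP (x \in ~` F).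
  by rewrite !inE => nFx; rewrite mem_set// => /EF.
exists (A `|` B); split => //.
  rewrite (le_lt_trans (measureU2 _ mA mB))//.
  by rewrite (splitr delta) EFinD lteD.
pose u : T -> R := a *: (fun x => (f : L0 mu) x * \1_(~` (A `|` B)) x) +
  (fun x => (g : L0 mu) x * \1_(~` (A `|` B)) x).
apply: (@Lfun_ae u); first exact: mI.
  near=> x.
  rewrite (near (L0_DE (a *: f) g) x)// (near (L0_ZE a f) x)//.
  by rewrite mulrDl -mulrA.
by rewrite rpredD ?rpredZ//; [apply: sub fA|apply: sub gB].
Unshelve. all: by end_near. Qed.

End Lambda.

Arguments Lambda {d T R} mu p.
Arguments in_Lambda {d T R} mu p.
Arguments alpha_norm {d T R} mu p f.
Arguments alpha_cvg {d T R} mu p f_ f.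

Section LambdaType.
Context d (T : measurableType d) (R : realType).
Variables (mu : {measure set T -> \bar R}) (p : R).

(* The bound 1 <= p is what makes Lambda mu p a vector subspace of L0 *)
Record LambdaType (p1 : 1 <= p) : Type := LambdaSub {
  Lambda_val :> L0 mu;
  Lambda_valP : Lambda_val \in in_Lambda mu p }.

Variable p1 : 1 <= p.

#[local] HB.instance Definition _ :=
  GRing.isSubmodClosed.Build R (L0 mu) (in_Lambda mu p) (Lambda_submod mu p1).

HB.instance Definition _ := [isSub for @Lambda_val p1].
HB.instance Definition _ := [Choice of LambdaType p1 by <:].
HB.instance Definition _ := [SubChoice_isSubLmodule of LambdaType p1 by <:].
End LambdaType.

Record fnorm (R : realType) (V : lmodType R) := FNorm {
  fnorm_fun :> V -> R;
  fnorm_ge0 : forall f, 0 <= fnorm_fun f;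
  fnorm_gt0 : forall f, f != 0 -> 0 < fnorm_fun f;
  fnormZ_le : forall (l : R) f, `|l| <= 1 -> fnorm_fun (l *: f) <= fnorm_fun f;
  fnorm_cvgZ : forall f, fnorm_fun (l *: f) @[l --> (0 : R)^'] --> 0;
  fnormD_le : forall f g, fnorm_fun (f + g) <= fnorm_fun f + fnorm_fun g }.

Section fnormed.
Context (R : realType) (V : lmodType R) (N : fnorm V).

Lemma fnorm0 : N 0 = 0.
Proof.
have h : (fun=> N 0) @ (0 : R)^' --> (0 : R).
  by have := fnorm_cvgZ N 0; under eq_fun do rewrite scaler0.
by apply: (cvg_unique _ _ h); [exact: Rhausdorff|exact: cvg_cst].
Qed.

Lemma fnormN f : N (- f) = N f.
Proof.
suff le g : N (- g) <= N g by apply/eqP; rewrite eq_le le/= -{1}(opprK f) le.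
by rewrite -scaleN1r fnormZ_le// normrN1.
Qed.

(* V, with the metric d(f, g) = N (f - g) *)
Definition fnormed (N : fnorm V) : Type := V.

HB.instance Definition _ := GRing.Lmodule.on (fnormed N).

Let dist (f g : fnormed N) : R := N (f - g).

Let distxx f : dist f f = 0. Proof. by rewrite /dist subrr fnorm0. Qed.

Let dist_eq0 f g : dist f g = 0 -> f = g.
Proof.
move=> d0; apply/eqP; rewrite -subr_eq0; apply/negP => /negP.
by move=> /(fnorm_gt0 N); rewrite -/(dist f g) d0 ltxx.
Qed.

Let distC f g : dist f g = dist g f.
Proof. by rewrite /dist -opprB fnormN. Qed.

Let dist_triangle g f h : dist f h <= dist f g + dist g h.
Proof. by rewrite /dist -(subrKA g) fnormD_le. Qed.

HB.instance Definition _ :=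
  isMetric.Build R (fnormed N) distxx dist_eq0 distC dist_triangle.

End fnormed.

(* V, with the translation-invariant metric of N, is an F-space *)
Definition Fspace (R : realType) (V : lmodType R) (N : fnorm V) : Prop :=
  [/\ continuous (fun z : fnormed N * fnormed N => z.1 + z.2),
      continuous (fun z : R^o * fnormed N => z.1 *: z.2),
      forall f g h : fnormed N, mdist (f + h) (g + h) = mdist f g &
      forall F : set_system (fnormed N), ProperFilter F -> cauchy F ->
        exists f : fnormed N, F --> f].

Section convergence_in_measure.
Context d (T : measurableType d) (R : realType).
Variable mu : {measure set T -> \bar R}.

Definition meas_inf (f : T -> R) : \bar R :=
  ereal_inf [set mu [set x | (delta < `|f x|)%R] + delta%:E
            | delta in [set delta : R | (0 < delta)%R]]%E.

(* The minimum with 1 makes meas_inf finite, so that fine is harmless *)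
Definition meas_norm (f : T -> R) : R := fine (mine (meas_inf f) 1%E).

Lemma meas_inf_ge0 f : (0 <= meas_inf f)%E.
Proof.
by apply: le_ereal_inf_tmp => _ [e /= e0 <-]; rewrite adde_ge0// lee_fin ltW.
Qed.

Lemma meas_normE f : (meas_norm f)%:E = mine (meas_inf f) 1%E.
Proof.
rewrite fineK// ge0_fin_numE; last by rewrite le_min meas_inf_ge0/=.
by rewrite gt_min ltry orbT.
Qed.

Lemma meas_inf_lt f (e : \bar R) : (meas_inf f < e)%E ->
  exists2 delta : R, 0 < delta &
    (mu [set x | (delta < `|f x|)%R] + delta%:E < e)%E.
Proof.
by move=> /ereal_inf_lt[_ [delta delta0 <-] ?]; exists delta.
Qed.

Lemma meas_inf_le f (delta : R) : 0 < delta ->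
  (meas_inf f <= mu [set x | (delta < `|f x|)%R] + delta%:E)%E.
Proof. by move=> delta0; apply: ereal_inf_lbound; exists delta. Qed.

Lemma measurable_gt_norm (f : T -> R) (delta : R) : measurable_fun setT f ->
  measurable [set x | delta < `|f x|].
Proof.
move=> mf; have mnf : measurable_fun setT (fun x => `|f x|).
  exact: measurableT_comp.
rewrite (_ : [set x | _] = setT `&` (fun x => `|f x|) @^-1` `]delta, +oo[).
  by apply: mnf => //; exact: measurable_itv.
by rewrite setTI; apply/seteqP; split => x /=; rewrite in_itv/= andbT.
Qed.

Lemma le_measure_ae (A B : set T) : measurable A -> measurable B ->
  (\forall x \ae mu, A x -> B x) -> (mu A <= mu B)%E.
Proof.
move=> mA mB [N [mN N0 AB]].
apply: (@le_trans _ _ (mu (B `|` N))); last first.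
  apply: le_trans (measureU2 _ mB mN) _.
  by rewrite [X in (_ + X)%E](_ : _ = 0%E) ?adde0//; exact: N0.
apply: le_measure; rewrite ?inE//; first exact: measurableU.
move=> x Ax; have [Bx|Bx] := pselect (B x); [by left|right].
by apply: AB => /(_ Ax).
Qed.

(* L0 with the metric d(f, g) = meas_norm (f - g) *)
Definition L0_measure : Type := L0 mu.

HB.instance Definition _ := GRing.Lmodule.on L0_measure.

Let dist (f g : L0_measure) : R := meas_norm (f - g : L0 mu).

Let le_norm_ae (f g : L0 mu) : (\forall x \ae mu, `|f x| = `|g x|) ->
  (meas_inf f <= meas_inf g)%E.
Proof.
move=> fg; apply: le_ereal_inf_tmp => _ [e /= e0 <-].
apply: le_trans (meas_inf_le _ e0) _; rewrite leeD2r//.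
apply: le_measure_ae; try exact/measurable_gt_norm/measurable_L0.
by apply: filterS fg => x /= ->.
Qed.

Let meas_normN (f : L0 mu) : meas_norm (- f : L0 mu) = meas_norm f.
Proof.
rewrite /meas_norm; congr (fine (mine _ _)); apply/eqP; rewrite eq_le.
by apply/andP; split; apply: le_norm_ae;
  apply: filterS (L0_NE f) => x ->; rewrite normrN.
Qed.

Let meas_norm0 : meas_norm (0 : L0 mu) = 0.
Proof.
apply/EFin_inj; rewrite meas_normE; apply/eqP; rewrite eq_le.
rewrite le_min meas_inf_ge0 lee01 !andbT ge_min; apply/orP; left.
apply/lee_addgt0Pr => e e0; rewrite add0e.
apply: le_trans (meas_inf_le _ e0) _.
rewrite (_ : mu _ = 0%E) ?add0e//; apply/eqP; rewrite -measure_le0.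
rewrite -(measure0 mu); apply: le_measure_ae => //.
  exact/measurable_gt_norm/measurable_L0.
apply: filterS (L0_0E mu) => x /= f0x.
by rewrite [L0_fun _ _]f0x normr0 ltNge ltW.
Qed.

Let meas_norm_eq0 (f : L0 mu) : meas_norm f = 0 -> f = 0.
Proof.
move=> f0; have inf0 (e : R) : 0 < e -> (meas_inf f < e%:E)%E.
  move=> e0; have f0E := congr1 EFin f0; rewrite meas_normE in f0E.
  have : (mine (meas_inf f) 1 < mine e%:E 1)%E.
    by rewrite f0E lt_min !lte_fin e0 ltr01.
  rewrite lt_min !gt_min ltxx orbF => /andP[/orP[//|e1] f1].
  exact: lt_trans f1 e1.
have null (n : nat) : mu [set x | n.+1%:R^-1 < `|f x|] = 0%E.
  apply/eqP; rewrite -measure_le0; apply/lee_addgt0Pr => e e0; rewrite add0e.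
  have me0 : 0 < Num.min n.+1%:R^-1 e by rewrite lt_min invr_gt0 ltr0n e0.
  have [delta delta0 lt_de] := meas_inf_lt (inf0 _ me0).
  have de : delta < Num.min n.+1%:R^-1 e.
    rewrite -lte_fin; apply: le_lt_trans lt_de.
    by rewrite leeDr// measure_ge0.
  have mude : (mu [set x | (delta < `|f x|)%R] <= e%:E)%E.
    apply: le_trans (_ : _ <= (Num.min n.+1%:R^-1 e)%:E)%E _; last first.
      by rewrite lee_fin ge_min lexx orbT.
    by apply: le_trans (ltW lt_de); rewrite leeDl// lee_fin ltW.
  apply: le_trans mude; apply: le_measure;
    rewrite ?inE; try exact/measurable_gt_norm/measurable_L0.
  move=> x /=; apply: lt_trans.
  by move: de; rewrite lt_min => /andP[].
apply/L0P.
have neg : mu.-negligible (\bigcup_n [set x | n.+1%:R^-1 < `|f x|]).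
  apply: negligible_bigcup => n; exists [set x | n.+1%:R^-1 < `|f x|].
  by split => //; exact/measurable_gt_norm/measurable_L0.
suff ae0 : \forall x \ae mu, f x = 0.
  by apply: filterS2 ae0 (L0_0E mu) => x -> ->.
apply: negligibleS neg => x /= /eqP fx0.
have : 0 < `|f x| by rewrite normr_gt0.
move=> /ltr_add_invr[n]; rewrite add0r => nfx.
by exists n.
Qed.

Let meas_normD (f g : L0 mu) :
  meas_norm (f + g : L0 mu) <= meas_norm f + meas_norm g.
Proof.
rewrite -lee_fin EFinD !meas_normE.
have ge0 h : (0 <= mine (meas_inf h) 1)%E by rewrite le_min meas_inf_ge0 lee01.
have [f1|f1] := leP 1%E (meas_inf f).
  by rewrite ge_min; apply/orP; right; rewrite leeDl.
have [g1|g1] := leP 1%E (meas_inf g).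
  by rewrite ge_min; apply/orP; right; rewrite leeDr// meas_inf_ge0.
have ffin : meas_inf f \is a fin_num.
  by rewrite ge0_fin_numE ?meas_inf_ge0// (lt_trans f1)// ltry.
have gfin : meas_inf g \is a fin_num.
  by rewrite ge0_fin_numE ?meas_inf_ge0// (lt_trans g1)// ltry.
rewrite ge_min; apply/orP; left; apply/lee_addgt0Pr => e e0.
have e20 : 0 < e / 2 by rewrite divr_gt0.
have [a a0 fa] : exists2 a : R, 0 < a &
    (mu [set x | (a < `|f x|)%R] + a%:E < meas_inf f + (e / 2)%:E)%E.
  by apply: meas_inf_lt; rewrite lteDl// lte_fin.
have [b b0 gb] : exists2 b : R, 0 < b &
    (mu [set x | (b < `|g x|)%R] + b%:E < meas_inf g + (e / 2)%:E)%E.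
  by apply: meas_inf_lt; rewrite lteDl// lte_fin.
apply: le_trans (meas_inf_le _ (addr_gt0 a0 b0)) _.
rewrite [in leRHS](splitr e) (EFinD (e / 2)) addeACA.
apply: le_trans (leeD (ltW fa) (ltW gb)).
rewrite (EFinD a) addeACA leeD2r//.
have mA (h : L0 mu) c : measurable [set x | c < `|h x|].
  exact/measurable_gt_norm/measurable_L0.
apply: le_trans (measureU2 _ (mA f a) (mA g b)).
apply: le_measure_ae => //; first exact: measurableU.
apply: filterS (L0_DE f g) => x /= ->; rewrite !ltNge => abfg.
apply/orP; rewrite -negb_and; apply: contra abfg => /andP[fxa gxb].
by rewrite (le_trans (ler_normD _ _))// lerD.
Qed.

Let distxx f : dist f f = 0.
Proof. by rewrite /dist subrr meas_norm0. Qed.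

Let dist_eq0 f g : dist f g = 0 -> f = g.
Proof. by move=> /meas_norm_eq0/eqP; rewrite subr_eq0 => /eqP. Qed.

Let distC f g : dist f g = dist g f.
Proof. by rewrite /dist -[in LHS]opprB meas_normN. Qed.

Let dist_triangle g f h : dist f h <= dist f g + dist g h.
Proof. by rewrite /dist -(subrKA g) meas_normD. Qed.

HB.instance Definition _ :=
  isMetric.Build R L0_measure distxx dist_eq0 distC dist_triangle.

End convergence_in_measure.

Section local_convergence_in_measure.
Context d (T : measurableType d) (R : realType).
Variable mu : {measure set T -> \bar R}.

(* L0 with the topology generated by the F-seminorms
   f |-> \int_F min(|f|, 1), for mu F < +oo: its subbasic open sets are the
   balls of these F-seminorms, indexed by (F, center, radius) *)
Definition L0_local : Type := L0 mu.

HB.instance Definition _ := GRing.Lmodule.on L0_local.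

HB.instance Definition _ := isPointed.Build (L0 mu) 0.

HB.instance Definition _ := @isSubBaseTopological.Build L0_local
  (set T * L0 mu * R)%type
  [set i | [/\ measurable i.1.1, (mu i.1.1 < +oo)%E & 0 < i.2]]
  (fun i => [set g : L0 mu | (\int[mu]_(x in i.1.1)
    (Num.min `|(g - i.1.2 : L0 mu) x| 1)%:E < i.2%:E)%E]).

End local_convergence_in_measure.

(* Main.v *)
Require Import Defs.
From HB Require Import structures.
From mathcomp Require Import all_boot all_order all_algebra.
From mathcomp Require Import all_classical all_reals all_analysis.
From mathcomp Require Import measurable_realfun.
From mathcomp Require Import ring lra.

(* The functional ||f||_alpha is a power of the truncated p-th moment
   M(f) = \int min(|f|, 1)^p.  Everything rests on two estimates: Markov's
   inequality e^p mu(|f| > e) <= M(f) for e <= 1, and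
   M(f) <= mu(E) + \int_{E^c} |f|^p for every measurable E.  They identify
   Lambda_p with {M < oo}, make M(f_n - f) -> 0 equivalent to asymptotic
   L_p-convergence (with B_n = {|f_n - f| <= 1}), and compare M with
   convergence in measure when mu is finite; the triangle inequality is
   Minkowski's applied to truncations.  For completeness, a sequence with
   ||f_(n+1) - f_n||_alpha < 4^-n converges a.e., because by Markov and
   Borel-Cantelli almost every point is eventually outside
   {|f_(n+1) - f_n| > 2^-n}; Fatou's lemma then turns the a.e. limit into a
   limit in the metric. *)

Set Implicit Arguments.
Unset Strict Implicit.
Unset Printing Implicit Defensive.

Import Order.TTheory GRing.Theory Num.Theory.
Import numFieldNormedType.Exports.
Local Open Scope classical_set_scope.
Local Open Scope ring_scope.

(** * Null sequences of nonnegative extended reals *)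

(** A nonnegative term below a real bound is finite, so eventually everything happens in the reals,
    through [fine]. *)
Lemma cvge0P (R : realType) (u : (\bar R)^nat) : (forall n, (0 <= u n)%E) ->
  u @ \oo --> 0%E <->
  forall e : R, 0 < e -> \forall n \near \oo, (u n < e%:E)%E.
Proof.
move=> u0; split=> [/fine_cvgP[ufin u_cvg0] e e0|u_small].
  near=> n; rewrite -(@fineK _ (u n)); last by near: n.
  by rewrite lte_fin; near: n; exact: cvgr_lt u_cvg0 _ e0.
have ufin : \forall n \near \oo, u n \is a fin_num.
  by apply: filterS (u_small 1 ltr01) => n un;
    rewrite ge0_fin_numE// (lt_trans un)// ltry.
apply/fine_cvgP; split => //; apply/cvgr0Pnorm_lt => e e0; near=> n.
rewrite ger0_norm ?fine_ge0// -lte_fin fineK; last by near: n.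
by near: n; exact: u_small.
Unshelve. all: by end_near. Qed.

(** * The truncated moment and its basic estimates *)

(** Taken on functions rather than on classes, so that it also applies to pointwise differences and
    to limits not yet turned into elements of [L0]. *)
HB.lock Definition trunc_moment d (T : measurableType d) (R : realType)
    (mu : {measure set T -> \bar R}) (p : R) (f : T -> R) : \bar R :=
  (\int[mu]_x (Num.min `|f x| 1 `^ p)%:E)%E.

Section truncated_moment.
Context d (T : measurableType d) (R : realType).
Variable mu : {measure set T -> \bar R}.
Implicit Types (p : R) (f g : T -> R).

Lemma measurable_powR_norm p f : measurable_fun setT f ->
  measurable_fun setT (fun x => (`|f x| `^ p)%:E).
Proof.
move=> mf; apply/measurable_EFinP.
apply: (@measurableT_comp _ _ _ _ _ _ (@powR R ^~ p)).
  exact: measurable_powR.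
exact: measurableT_comp.
Qed.

Lemma measurable_powR_trunc p f : measurable_fun setT f ->
  measurable_fun setT (fun x => (Num.min `|f x| 1 `^ p)%:E).
Proof.
move=> mf; apply/measurable_EFinP.
apply: (@measurableT_comp _ _ _ _ _ _ (@powR R ^~ p)).
  exact: measurable_powR.
by apply: measurable_minr => //; exact: measurableT_comp.
Qed.

Lemma trunc_ge0 (a : R) : 0 <= Num.min `|a| 1.
Proof. by rewrite le_min normr_ge0 ler01. Qed.

(** Truncation at 1 is subadditive on nonnegative reals: a summand above 1 alone already dominates
    the left side. *)
Lemma trunc_le_add (a b c : R) : `|a| <= `|b| + `|c| ->
  Num.min `|a| 1 <= Num.min `|b| 1 + Num.min `|c| 1.
Proof.
move=> abc.
have [b1|b1] := leP `|b| 1; last by rewrite ge_min lerDl trunc_ge0 orbT.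
have [c1|c1] := leP `|c| 1; last by rewrite ge_min lerDr normr_ge0 orbT.
by rewrite ge_min abc.
Qed.

Lemma trunc_moment_ge0 p f : (0 <= trunc_moment mu p f)%E.
Proof.
rewrite trunc_moment.unlock; apply: integral_ge0 => x _.
by rewrite lee_fin powR_ge0.
Qed.

Hint Resolve trunc_ge0 : core.

(** The comparison is a.e. because the operations of [L0] are pointwise only a.e. *)
Lemma le_trunc_moment p f g : 0 <= p ->
  measurable_fun setT f -> measurable_fun setT g ->
  (\forall x \ae mu, `|f x| <= `|g x|) ->
  (trunc_moment mu p f <= trunc_moment mu p g)%E.
Proof.
move=> p0 mf mg fg; rewrite trunc_moment.unlock.
apply: ae_ge0_le_integral => //.
- exact: measurable_powR_trunc.
- exact: measurable_powR_trunc.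
apply: filterS fg => x fgx _; rewrite lee_fin ge0_ler_powR ?nnegrE//.
by rewrite le_min !ge_min fgx lexx !orbT.
Qed.

Lemma eq_trunc_moment p f g : 0 <= p ->
  measurable_fun setT f -> measurable_fun setT g ->
  (\forall x \ae mu, `|f x| = `|g x|) ->
  trunc_moment mu p f = trunc_moment mu p g.
Proof.
move=> p0 mf mg fg; apply: le_anti.
by apply/andP; split; apply: le_trunc_moment => //; apply: filterS fg => x ->.
Qed.

Lemma trunc_moment_Lnorm p f :
  'N[mu]_p%:E[EFin \o (fun x => Num.min `|f x| 1)%R]%E =
  (trunc_moment mu p f `^ p^-1)%E.
Proof.
rewrite Lnorm.unlock trunc_moment.unlock.
apply: (congr1 (fun z => z `^ p^-1)%E); apply: eq_integral => x _ /=.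
by rewrite ger0_norm.
Qed.

(** On {|f| > e} the bound e <= 1 gives min(|f|, 1) >= e, so Markov's argument survives the
    truncation. *)
Lemma trunc_moment_markov p f (e : R) : 0 <= p -> measurable_fun setT f ->
  0 < e <= 1 ->
  ((e `^ p)%:E * mu [set x | (e < `|f x|)%R] <= trunc_moment mu p f)%E.
Proof.
move=> p0 mf /andP[e0 e1].
have mA := measurable_gt_norm e mf.
rewrite trunc_moment.unlock -integral_cst//; apply: (@le_trans _ _
  (\int[mu]_(x in [set x | (e < `|f x|)%R]) (Num.min `|f x| 1 `^ p)%:E)%E).
  apply: ge0_le_integral => //.
  - by move=> x _; rewrite lee_fin powR_ge0.
  - by apply: measurable_funTS; exact: measurable_powR_trunc.
  - move=> x /= ex; rewrite lee_fin ge0_ler_powR ?nnegrE// ?(ltW e0)//.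
    by rewrite le_min (ltW ex).
by apply: ge0_subset_integral => //; exact: measurable_powR_trunc.
Qed.

Lemma trunc_moment_markov1 p f : 0 <= p -> measurable_fun setT f ->
  (mu [set x | (1 < `|f x|)%R] <= trunc_moment mu p f)%E.
Proof.
move=> p0 mf; have := @trunc_moment_markov p f 1 p0 mf.
by rewrite ltr01 lexx powR1 mul1e; apply.
Qed.

(** The integrand is at most 1 on E and at most |f|^p off E. *)
Lemma trunc_moment_le_setC p f (E : set T) : 0 <= p -> measurable_fun setT f ->
  measurable E ->
  (trunc_moment mu p f <= mu E + \int[mu]_(x in ~` E) (`|f x| `^ p)%:E)%E.
Proof.
move=> p0 mf mE; have mEc := measurableC mE.
rewrite trunc_moment.unlock -(setUv E) ge0_integral_setU//=; last 2 first.
- by rewrite setUv; exact: measurable_powR_trunc.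
- by apply/disj_set2P; rewrite setICr.
apply: leeD.
  rewrite -[leRHS]mul1e -integral_cst//; apply: ge0_le_integral => //.
  - by apply: measurable_funTS; exact: measurable_powR_trunc.
  move=> x _; rewrite lee_fin.
  apply: (@le_trans _ _ (1 `^ p)); last by rewrite powR1.
  by rewrite ge0_ler_powR ?nnegrE// ge_min lexx orbT.
apply: ge0_le_integral => //.
- by apply: measurable_funTS; exact: measurable_powR_trunc.
- by apply: measurable_funTS; exact: measurable_powR_norm.
move=> x _; rewrite lee_fin ge0_ler_powR ?nnegrE//.
by rewrite ge_min lexx.
Qed.

(** Where |f| <= c, the bound c >= 1 gives |f| <= c min(|f|, 1). This leads back from the truncated
    moment to an untruncated one. *)
Lemma le_integral_trunc_moment p f (c : R) : 0 <= p -> measurable_fun setT f ->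
  1 <= c ->
  (\int[mu]_(x in ~` [set x | (c < `|f x|)%R]) (`|f x| `^ p)%:E <=
   (c `^ p)%:E * trunc_moment mu p f)%E.
Proof.
move=> p0 mf c1; have c0 : 0 <= c by rewrite (le_trans ler01).
have mA := measurableC (measurable_gt_norm c mf).
rewrite trunc_moment.unlock -ge0_integralZl//; last 2 first.
- exact: measurable_powR_trunc.
- by rewrite lee_fin powR_ge0.
apply: (@le_trans _ _ (\int[mu]_(x in ~` [set x | (c < `|f x|)%R])
    ((c `^ p)%:E * (Num.min `|f x| 1 `^ p)%:E))%E).
  apply: ge0_le_integral => //.
  - by apply: measurable_funTS; exact: measurable_powR_norm.
  - apply: measurable_funTS; apply: measurable_funeM.
    exact: measurable_powR_trunc.
  move=> x /= /negP; rewrite -leNgt => fc; rewrite -EFinM lee_fin -powRM//.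
  rewrite ge0_ler_powR ?nnegrE// ?mulr_ge0//.
  have [f1|f1] := leP `|f x| 1; last by rewrite mulr1.
  by rewrite ler_peMl.
apply: ge0_subset_integral => //.
- by apply: measurable_funeM; exact: measurable_powR_trunc.
- by move=> x _; rewrite -EFinM lee_fin mulr_ge0// powR_ge0.
Qed.

Lemma trunc_moment_eq0 p f : 0 < p -> measurable_fun setT f ->
  trunc_moment mu p f = 0%E -> \forall x \ae mu, f x = 0.
Proof.
move=> p0 mf f0.
have /ae_eq_integral_abs h :
    measurable_fun setT (fun x => (Num.min `|f x| 1 `^ p)%:E).
  exact: measurable_powR_trunc.
have /h : (\int[mu]_x `|(Num.min `|f x| 1 `^ p)%:E| = 0)%E.
  rewrite -{}[RHS]f0 trunc_moment.unlock; apply: eq_integral => x _.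
  by rewrite gee0_abs// lee_fin powR_ge0.
move=> /(_ measurableT); apply: filterS => x /(_ Logic.I) /= [] /powR_eq0_eq0.
by case: leP => [_ /normr0_eq0//|_ /eqP]; rewrite oner_eq0.
Qed.

End truncated_moment.

(** * Continuity of the operations and completeness for an F-norm *)

Section fnormed_theory.
Context (R : realType) (V : lmodType R) (N : fnorm V).
Implicit Types f g h : fnormed N.

Lemma fnormed_mdistE f g : mdist f g = N (f - g).
Proof. by []. Qed.

Lemma fnorm_natmul_le (f : V) n : N (f *+ n) <= N f *+ n.
Proof.
elim: n => [|n IHn]; first by rewrite !mulr0n fnorm0.
by rewrite !mulrS (le_trans (fnormD_le _ _ _))// lerD2l.
Qed.

(** The axioms control scalars of modulus at most 1: write a f as (a / (n+1)) times (n+1) f and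
    bound the multiple by subadditivity. *)
Lemma fnormZ_le_natmul (a : R) (f : V) n : `|a| <= n.+1%:R ->
  N (a *: f) <= N f *+ n.+1.
Proof.
move=> an; apply: le_trans (fnorm_natmul_le f n.+1).
have -> : a *: f = (a / n.+1%:R) *: (f *+ n.+1).
  by rewrite -(scaler_nat n.+1 f) scalerA divfK.
by apply: fnormZ_le; rewrite normrM normfV normr_nat ler_pdivrMr// mul1r.
Qed.

Lemma fnormed_nbhs f (e : R) : 0 < e -> \forall g \near f, N (f - g) < e.
Proof. by move=> e0; apply/metricType_numDomainType.nbhs_mdistP; exists e. Qed.

Lemma fnormed_add_continuous :
  continuous (fun z : fnormed N * fnormed N => z.1 + z.2).
Proof.
move=> [f g]; apply/metricType_numDomainType.cvgrPdist_lt => e e0 /=.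
have e20 : 0 < e / 2 by rewrite divr_gt0.
have fe : \forall z \near (f, g), N (f - z.1) < e / 2.
  exact: (@cvg_fst _ _ (nbhs f) (nbhs g) _ _ (fnormed_nbhs f e20)).
have ge : \forall z \near (f, g), N (g - z.2) < e / 2.
  exact: (@cvg_snd _ _ (nbhs f) (nbhs g) _ _ (fnormed_nbhs g e20)).
apply: filterS2 fe ge => z fz gz.
rewrite fnormed_mdistE opprD addrACA (splitr e).
exact: le_lt_trans (fnormD_le _ _ _) (ltrD fz gz).
Qed.

Lemma fnormed_scale_continuous :
  continuous (fun z : R^o * fnormed N => z.1 *: z.2).
Proof.
move=> [a f]; apply/metricType_numDomainType.cvgrPdist_lt => e e0 /=.
have e20 : 0 < e / 2 by rewrite divr_gt0.
pose n := Num.bound (`|a| + 1).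
have en : 0 < e / 2 / n.+1%:R by rewrite divr_gt0.
have scale_small : \forall b \near (a : R^o), N ((a - b) *: f) < e / 2.
  have l_small : \forall l \near (0 : R), N (l *: f) < e / 2.
    have : \forall l \near (0 : R)^', N (l *: f) < e / 2.
      exact: cvgr_lt (fnorm_cvgZ N f) _ e20.
    (* [fnorm_cvgZ] concerns a punctured neighbourhood of 0; at l = 0 the value is N 0 = 0. *)
    rewrite near_withinE; apply: filterS => l fl.
    by have [->|/fl//] := eqVneq l 0; rewrite scale0r fnorm0.
  have ab0 : (a - b) @[b --> (a : R^o)] --> (0 : R).
    by rewrite -(subrr a); apply: cvgB; [exact: cvg_cst|exact: cvg_id].
  exact: ab0 _ l_small.
have near_a : \forall b \near (a : R^o), `|b| <= n.+1%:R.
  have : \forall b \near (a : R^o), `|a - b| < 1.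
    exact: (nbhsx_ballx (a : R) 1 ltr01).
  apply: filterS => b /ltW ab; apply: (@le_trans _ _ (`|a| + 1)).
    by rewrite -lerBlDl (le_trans _ ab)// distrC lerB_dist.
  by rewrite ltW// (lt_trans (archi_boundP _))// ?ltr_nat// addr_ge0.
have az : \forall z \near (a : R^o, f), N ((a - z.1) *: f) < e / 2.
  exact: (@cvg_fst _ _ (nbhs (a : R^o)) (nbhs f) _ _ scale_small).
have bz : \forall z \near (a : R^o, f), `|z.1| <= n.+1%:R.
  exact: (@cvg_fst _ _ (nbhs (a : R^o)) (nbhs f) _ _ near_a).
have fz : \forall z \near (a : R^o, f), N (f - z.2) < e / 2 / n.+1%:R.
  exact: (@cvg_snd _ _ (nbhs (a : R^o)) (nbhs f) _ _ (fnormed_nbhs f en)).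
apply: filterS3 az bz fz => -[b g] /= az bz fz.
(* The first term is small by continuity in the scalar at fixed f; the second because |b| <= n+1 for
   b near a. *)
rewrite fnormed_mdistE (_ : a *: f - b *: g =
  (a - b) *: f + b *: (f - g)); last first.
  by rewrite scalerBl scalerBr addrA subrK.
rewrite (splitr e); apply: le_lt_trans (fnormD_le _ _ _) (ltrD az _).
apply: le_lt_trans (fnormZ_le_natmul _ bz) _.
by rewrite -[ltLHS]mulr_natr -ltr_pdivlMr.
Qed.

(** A Cauchy filter contains balls of radius 4^-n / 2; their centres have geometric steps, and a
    limit of the centres is a limit of the filter. *)
Lemma fnormed_complete :
  (forall u : nat -> V, (forall n, N (u n.+1 - u n) < 4^-1 ^+ n) ->
    exists f : V, N (u n - f) @[n --> \oo] --> 0) ->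
  forall F : set_system (fnormed N), ProperFilter F -> cauchy F ->
    exists f : fnormed N, F --> f.
Proof.
move=> fast_cvg F FF /cauchy_ballP Fc.
have q0 n : 0 < 4^-1 ^+ n / 2 :> R by rewrite divr_gt0// exprn_gt0// invr_gt0.
have /choice[u Fu] : forall n, exists f : fnormed N, F (ball f (4^-1 ^+ n / 2)).
  move=> n; have [[P Q] /= [FP FQ] PQ] := Fc _ (q0 n).
  have [f Pf] := filter_ex FP; exists f.
  by apply: filterS FQ => g Qg; exact: (PQ (f, g)).
have uN n : N (u n.+1 - u n) < 4^-1 ^+ n.
  (* Two members of a proper filter meet; the common point g gives the bound 4^-(n+1) / 2 + 4^-n / 2
     <= 4^-n. *)
  have [g []] := filter_ex (filterI (Fu n.+1) (Fu n)).
  rewrite !ballEmdist /= => ug ug'.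
  apply: (@le_lt_trans _ _ (mdist (u n.+1) g + mdist (u n) g)).
    by rewrite (metric_sym (u n) g); exact: (metric_triangle (u n.+1) g (u n)).
  rewrite [ltRHS]splitr ltrD//; apply: lt_le_trans ug _.
  rewrite ler_pM2r ?invr_gt0// exprS ler_piMl ?exprn_ge0 ?invr_ge0//.
  by rewrite invf_le1// ler1n.
have [f uf] := fast_cvg u uN.
exists f; apply/metricType_numDomainType.fcvgrPdist_lt => e e0.
have e20 : 0 < e / 2 by rewrite divr_gt0.
have /(cvgr_lt _) /(_ _ e20) [m _ mq] : (4^-1 ^+ n : R) @[n --> \oo] --> 0.
  by apply: cvg_expr; rewrite ger0_norm ?invr_ge0// invf_lt1// ltr1n.
have /(cvgr_lt _) /(_ _ e20) [k _ kq] := uf.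
pose n := maxn m k.
apply: filterS (Fu n) => g; rewrite ballEmdist /= => ug.
apply: (@le_lt_trans _ _ (mdist (u n) (f : fnormed N) + mdist (u n) g)).
  rewrite (metric_sym (u n) (f : fnormed N)).
  exact: (metric_triangle (f : fnormed N) (u n) g).
rewrite (splitr e) ltrD//; first by apply: kq; exact: leq_maxr.
apply: lt_trans ug _; apply: (@le_lt_trans _ _ (4^-1 ^+ n)).
  by rewrite ler_piMr ?exprn_ge0 ?invr_ge0// invf_le1// ler1n.
by apply: mq; exact: leq_maxl.
Qed.

End fnormed_theory.

(** * Lambda_p as the set of finite truncated moment *)

Section Lambda_moment.
Context d (T : measurableType d) (R : realType).
Variables (mu : {measure set T -> \bar R}) (p : R).
Hypothesis p1 : 1 <= p.
Implicit Types f g h : T -> R.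

#[local] Hint Resolve trunc_ge0 : core.

Let p0 : 0 < p. Proof. exact: lt_le_trans p1. Qed.
Let p0' : 0 <= p. Proof. exact: ltW. Qed.

Lemma alpha_normE (f : L0 mu) :
  alpha_norm mu p f = (trunc_moment mu p f `^ p^-1)%E.
Proof. exact: trunc_moment_Lnorm. Qed.

(** Passes from the indicator form in the definition of [Lambda] to the set integrals of the moment
    estimates. *)
Lemma Lfun_indic f (D : set T) : measurable_fun setT f -> measurable D ->
  ((fun x => f x * \1_D x) \in Lfun mu p%:E) <->
  (\int[mu]_(x in D) (`|f x| `^ p)%:E < +oo)%E.
Proof.
move=> mf mD; set g := (X in X \in _).
have mg : measurable_fun setT g.
  by apply: measurable_funM => //; exact: measurable_indic.
have -> : (\int[mu]_(x in D) (`|f x| `^ p)%:E =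
    \int[mu]_x (`|(EFin \o g) x| `^ p))%E.
  rewrite integral_mkcond; apply: eq_integral => x _.
  rewrite /= patchE /g indicE.
  by case: ifPn => _; rewrite ?mulr1// mulr0 normr0 powR0// gt_eqF.
have pV : 0 <= p^-1 by rewrite invr_ge0.
split=> [/andP[_ /[!inE]/=]|h].
  by rewrite /finite_norm unlock => /lty_poweRy; apply; rewrite invr_eq0 gt_eqF.
apply/andP; split; rewrite inE//=.
by rewrite /finite_norm unlock poweR_lty.
Qed.

(** E is {|f| > n+1} for some large n: these sets decrease to the empty set, and off each of them
    |f| is bounded, so [le_integral_trunc_moment] applies. *)
Lemma trunc_moment_lty_approx f (e : R) : measurable_fun setT f ->
  (trunc_moment mu p f < +oo)%E -> 0 < e ->
  exists E : set T, [/\ measurable E, (mu E < e%:E)%E &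
    (\int[mu]_(x in ~` E) (`|f x| `^ p)%:E < +oo)%E].
Proof.
move=> mf foo e0.
pose F (n : nat) := [set x | n.+1%:R < `|f x|].
have mF n : measurable (F n) by exact: measurable_gt_norm.
have F0 : \bigcap_n F n = set0.
  apply/seteqP; split => // x /(_ (Num.bound `|f x|) Logic.I); rewrite /F /=.
  apply/negP; rewrite -leNgt ltW//.
  by rewrite (lt_trans (archi_boundP _))// ltr_nat.
have /cvge0P/(_ e e0) : mu (F n) @[n --> \oo] --> 0%E.
  (* Continuity from above requires the first set to have finite measure, which is Markov's
     inequality at level 1. *)
  rewrite -(measure0 mu) -F0; apply: nonincreasing_cvg_mu => //.
  - exact: le_lt_trans (trunc_moment_markov1 mu p0' mf) foo.
  - exact: bigcap_measurable.
  - move=> m n mn; apply/subsetPset => x /=; apply: le_lt_trans.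
    by rewrite ler_nat.
move=> /(_ (fun=> measure_ge0 _ _))[n _ /(_ n (leqnn n)) /= Fn].
exists (F n); split; [exact: mF|exact: Fn|].
apply: le_lt_trans (le_integral_trunc_moment mu p0' mf _) _.
  by rewrite ler1n.
by rewrite lte_mul_pinfty// lee_fin powR_ge0.
Qed.

(** Membership with delta = 1 already bounds the moment; conversely a finite moment yields
    exceptional sets of every size. *)
Lemma Lambda_trunc_moment (f : L0 mu) :
  Lambda mu p f <-> (trunc_moment mu p f < +oo)%E.
Proof.
have mf := measurable_L0 f.
split=> [/(_ 1 ltr01)[E [mE E1]]|foo e e0].
  move=> /(Lfun_indic mf (measurableC mE)) fE.
  apply: le_lt_trans (trunc_moment_le_setC mu p0' mf mE) _.
  by rewrite lte_add_pinfty// (lt_trans E1)// ltry.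
have [E [mE Ee fE]] := trunc_moment_lty_approx mf foo e0.
by exists E; split => //; apply/Lfun_indic => //; exact: measurableC.
Qed.

(** On an exceptional set of measure below e / 2 truncation caps the contribution for every l; off
    it the p-th moment is finite and scales by |l|^p. *)
Lemma trunc_moment_scale_small f (e : R) : measurable_fun setT f ->
  (trunc_moment mu p f < +oo)%E -> 0 < e ->
  exists2 c : R, 0 < c & forall l, `|l| < c ->
    (trunc_moment mu p (fun x => (l * f x)%R) < e%:E)%E.
Proof.
move=> mf foo e0; have e20 : 0 < e / 2 by rewrite divr_gt0.
have [E [mE Ee fE]] := trunc_moment_lty_approx mf foo e20.
set I := (\int[mu]_(x in _) _)%E in fE.
have I0 : (0 <= I)%E by apply: integral_ge0 => x _; rewrite lee_fin powR_ge0.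
have IE : I = (fine I)%:E by rewrite fineK// ge0_fin_numE.
have I1 : 0 < fine I + 1 by rewrite ltr_wpDl// fine_ge0.
(* c solves c^p (I + 1) = e / 2; adding 1 keeps the denominator positive when I = 0. *)
pose c := (e / 2 / (fine I + 1)) `^ p^-1.
have c0 : 0 < c by rewrite powR_gt0// divr_gt0.
exists c => // l lc.
have ml : measurable_fun setT (fun x => l * f x) by exact: measurable_funM.
apply: le_lt_trans (trunc_moment_le_setC mu p0' ml mE) _.
have -> : (\int[mu]_(x in ~` E) (`|l * f x| `^ p)%:E = (`|l| `^ p)%:E * I)%E.
  rewrite -ge0_integralZl//=; last 2 first.
  - exact: measurableC.
  - by apply: measurable_funTS; exact: measurable_powR_norm.
  by apply: eq_integral => x _; rewrite normrM powRM.
rewrite IE -EFinM (splitr e) EFinD; apply: lte_leD => //; rewrite lee_fin.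
apply: (@le_trans _ _ (c `^ p * (fine I + 1))).
  rewrite ler_pM ?powR_ge0 ?fine_ge0//; last by rewrite lerDl.
  by rewrite ge0_ler_powR ?nnegrE// ltW.
rewrite -powRrM mulVf ?gt_eqF// powRr1; last by rewrite ltW// divr_gt0.
by rewrite divfK// gt_eqF.
Qed.

(** The sum of min(|f|, 1) and min(|g|, 1) dominates min(|h|, 1) a.e. Stated by domination, it
    serves sums, telescoping differences and limits alike. *)
Lemma trunc_moment_triangle f g h :
  measurable_fun setT f -> measurable_fun setT g -> measurable_fun setT h ->
  (\forall x \ae mu, `|h x| <= `|f x| + `|g x|) ->
  (trunc_moment mu p h `^ p^-1 <=
   trunc_moment mu p f `^ p^-1 + trunc_moment mu p g `^ p^-1)%E.
Proof.
move=> mf mg mh hfg.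
have mtrunc (u : T -> R) : measurable_fun setT u ->
    measurable_fun setT (fun x => Num.min `|u x| 1 : R).
  by move=> mu'; apply: measurable_minr => //; exact: measurableT_comp.
rewrite -(trunc_moment_Lnorm mu p f) -(trunc_moment_Lnorm mu p g).
apply: le_trans (minkowski_EFin mu (mtrunc _ mf) (mtrunc _ mg) p1).
rewrite Lnorm.unlock; apply: gt0_ler_poweR.
- by rewrite invr_ge0.
- by rewrite in_itv/= leey trunc_moment_ge0.
- by rewrite in_itv/= leey integral_ge0.
rewrite trunc_moment.unlock; apply: ae_ge0_le_integral => //.
- exact: measurable_powR_trunc.
- by move=> x _; rewrite poweR_ge0.
- exact: (measurable_powR_norm p (measurable_funD (mtrunc _ mf) (mtrunc _ mg))).
apply: filterS hfg => x hx _; rewrite lee_fin ge0_ler_powR ?nnegrE//=.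
rewrite [leRHS]ger0_norm ?addr_ge0//.
exact: trunc_le_add.
Qed.

End Lambda_moment.

(** * Numerical lemmas on geometric steps and powers *)

Lemma geometric_steps_cvg (R : realType) (u : R^nat) (m : nat) :
  (forall n, (m <= n)%N -> `|u n.+1 - u n| <= 2^-1 ^+ n) -> cvgn u.
Proof.
move=> um.
have q0 n : 0 <= 2^-1 ^+ n :> R by rewrite exprn_ge0// invr_ge0.
(* The subtracted term makes the induction exact: adding a step 2^-(n+k) turns the bound for k into
   the bound for k+1. *)
have uk n k : (m <= n)%N ->
    `|u (n + k)%N - u n| <= 2 * (2^-1 ^+ n - 2^-1 ^+ (n + k)).
  move=> mn; elim: k => [|k IHk]; first by rewrite addn0 !subrr normr0 mulr0.
  have -> : u (n + k.+1)%N - u n =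
      (u (n + k).+1 - u (n + k)%N) + (u (n + k)%N - u n).
    by rewrite addnS addrA subrK.
  apply: le_trans (ler_normD _ _) _.
  apply: le_trans (lerD (um _ (leq_trans mn (leq_addr _ _))) IHk) _.
  rewrite addnS [in leRHS]exprS; lra.
apply/cauchy_cvgP; apply: cauchy_exP => e e0.
have : (2^-1 ^+ n : R) @[n --> \oo] --> 0.
  by apply: cvg_expr; rewrite ger0_norm ?invr_ge0// invf_lt1// ltr1n.
have e20 : 0 < e / 2 by rewrite divr_gt0.
move=> /(cvgr_lt _) /(_ _ e20) [k _ kq].
pose n := maxn m k; exists (u n); exists n => // j /= nj.
rewrite /ball /= distrC -(subnKC nj).
apply: le_lt_trans (uk _ _ (leq_maxl _ _)) _.
have := kq n (leq_maxr _ _); have := q0 (n + (j - n))%N; rewrite /=; lra.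
Qed.

Lemma powR_mono (R : realType) (p : R) : 0 < p ->
  {in Num.nneg &, {mono (@powR R)^~ p : x y / x <= y}}.
Proof.
by move=> p0; apply: le_mono_in; exact: gt0_ltr_powR.
Qed.

(** Trades the p-th root in the norm for a p-th power of the bound; X = +oo stays infinite because
    p^-1 is nonzero. *)
Lemma poweRV_le (R : realType) (p c : R) (X : \bar R) :
  0 < p -> 0 <= c -> (0 <= X)%E ->
  (X `^ p^-1 <= c%:E)%E = (X <= (c `^ p)%:E)%E.
Proof.
move=> p0 c0; have pV0 : p^-1 != 0 by rewrite invr_eq0 gt_eqF.
case: X => [x| |] //; last by rewrite poweRyr// !leye_eq.
rewrite poweR_EFin !lee_fin => x0.
rewrite -(powR_mono p0) ?nnegrE ?powR_ge0//.
by rewrite -powRrM mulVf ?gt_eqF// powRr1.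
Qed.

Lemma poweRV_lt (R : realType) (p c : R) (X : \bar R) :
  0 < p -> 0 <= c -> (0 <= X)%E ->
  (X `^ p^-1 < c%:E)%E = (X < (c `^ p)%:E)%E.
Proof.
move=> p0 c0; have pV0 : p^-1 != 0 by rewrite invr_eq0 gt_eqF.
case: X => [x| |] //; last by rewrite poweRyr// !ltNge !leey.
rewrite poweR_EFin !lte_fin => x0.
rewrite -(leW_mono_in (powR_mono p0)) ?nnegrE ?powR_ge0//.
by rewrite -powRrM mulVf ?gt_eqF// powRr1.
Qed.

(** For a > 0 the power function is differentiable at a. At a = 0 the argument is direct: u n <
    e^(1/p) forces (u n)^p < e. *)
Lemma cvg_powR_nneg (R : realType) (p a : R) (u : R^nat) : 0 < p ->
  (forall n, 0 <= u n) -> 0 <= a ->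
  u @ \oo --> a -> (fun n => u n `^ p) @ \oo --> a `^ p.
Proof.
move=> p0 u0; rewrite le_eqVlt => /predU1P[<-|a0] ua.
  rewrite powR0 ?gt_eqF//; apply/cvgr0Pnorm_lt => e e0.
  have eV0 : 0 < e `^ p^-1 by rewrite powR_gt0.
  have : \forall n \near \oo, u n < e `^ p^-1 by exact: cvgr_lt ua _ eV0.
  apply: filterS => n une.
  rewrite ger0_norm ?powR_ge0//; have := gt0_ltr_powR p0.
  move=> /(_ (u n) (e `^ p^-1)); rewrite !nnegrE u0 powR_ge0.
  move=> /(_ isT isT une).
  by rewrite -powRrM mulVf ?gt_eqF// powRr1// ltW.
suff : {for a, continuous (@powR R ^~ p)} by exact: cvg_comp ua.
apply/differentiable_continuous/derivable1_diffP/derivable_powR.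
by rewrite in_itv/= a0.
Qed.

(** * Limits of sequences with geometrically small steps *)

Section fast_cauchy.
Context d (T : measurableType d) (R : realType).
Variable mu : {measure set T -> \bar R}.
Implicit Types (p : R) (v : (T -> R)^nat).

(** Fatou's lemma on the complement of the null set N, where the lower limit is the limit. *)
Lemma fatou_cvg (g : (T -> \bar R)^nat) (f : T -> \bar R) (N : set T)
    (c : \bar R) :
  measurable N -> mu N = 0%E ->
  (forall n, measurable_fun setT (g n)) -> measurable_fun setT f ->
  (forall n x, (0 <= g n x)%E) -> (forall x, (0 <= f x)%E) ->
  (forall x, ~ N x -> g ^~ x @ \oo --> f x) ->
  (forall n, (\int[mu]_x g n x <= c)%E) -> (\int[mu]_x f x <= c)%E.
Proof.
move=> mN N0 mg mf g0 f0 gf gc; have mNc := measurableC mN.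
rewrite (ge0_negligible_integral mN)//= ?setTD//.
have -> : (\int[mu]_(x in ~` N) f x =
    \int[mu]_(x in ~` N) limn_einf (g ^~ x))%E.
  apply: eq_integral => x /[!inE] Nx.
  by rewrite (cvg_limn_einf_sup (gf _ Nx)).1.
apply: le_trans (fatou _ mNc _ _) _ => //.
  by move=> n; exact: measurable_funTS.
(* The lower limit of the integrals is a limit of tail infima, each at most one of the integrals and
   hence at most c. *)
rewrite limn_einf_lim; apply: lime_le; first exact: is_cvg_einfs.
apply: nearW => n; apply: le_trans (gc n).
apply: (@le_trans _ _ (\int[mu]_(x in ~` N) g n x)%E).
  by apply: ereal_inf_lbound; exists n => /=.
exact: ge0_subset_integral.
Qed.

(** Multiplying by the indicator of the complement of N makes the sequence converge everywhere, so
    its pointwise limit is measurable. *)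
Lemma ae_cvg_measurable_lim v : (forall n, measurable_fun setT (v n)) ->
  (\forall x \ae mu, cvgn (v ^~ x)) ->
  exists f N, [/\ measurable_fun setT f, measurable N, mu N = 0%E &
    forall x, ~ N x -> v ^~ x @ \oo --> (f x : R)].
Proof.
move=> mv [N [mN N0 vN]].
pose w n x := v n x * \1_(~` N) x.
have wcvg x : cvgn (w ^~ x).
  have [Nx|Nx] := pselect (N x).
    rewrite /w indicE memNset; last by move=> /(_ Nx).
    under eq_fun do rewrite mulr0.
    exact: is_cvg_cst.
  rewrite /w indicE mem_set//; under eq_fun do rewrite mulr1.
  by apply: contrapT => /vN.
exists (fun x => limn (w ^~ x)), N; split => //.
  apply: (measurable_fun_cvg (h := w)) => //.
  move=> n; apply: measurable_funM => //.
  by apply: measurable_indic; exact: measurableC.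
move=> x Nx; have := wcvg x; rewrite /w indicE mem_set//.
by under eq_fun do rewrite mulr1.
Qed.

Lemma fast_cauchy_ae_cvg p v : 1 <= p ->
  (forall n, measurable_fun setT (v n)) ->
  (forall n,
    (trunc_moment mu p (v n.+1 \- v n)%R <= ((4^-1 ^+ n) `^ p)%:E)%E) ->
  \forall x \ae mu, cvgn (v ^~ x).
Proof.
move=> p1 mv vp; have p0 : 0 <= p by rewrite (le_trans ler01).
pose F n := [set x | (2^-1 ^+ n < `|v n.+1 x - v n x|)%R].
have mvv n : measurable_fun setT (v n.+1 \- v n) by exact: measurable_funB.
have mF n : measurable (F n) by apply: measurable_gt_norm; exact: mvv.
have q01 n : 0 < (2^-1 ^+ n : R) <= 1.
  by rewrite exprn_gt0 ?invr_gt0//= exprn_ile1 ?invr_ge0// invf_le1// ler1n.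
(* 4^-n splits as 2^-n for the Markov threshold and 2^-n for the measure: mu (F n) <= (2^-n)^p <=
   2^-n. The form 2 / 2^(n+1) fits [epsilon_trick0]. *)
have muF n : (mu (F n) <= (2 / (2 ^ n.+1)%:R)%:E)%E.
  have /andP[q0 q1] := q01 n.
  have := le_trans (trunc_moment_markov mu p0 (mvv n) (q01 n)) (vp n).
  rewrite (_ : 4^-1 = 2^-1 * 2^-1); last by rewrite -invfM -natrM.
  rewrite exprMn powRM ?(ltW q0)// [in leRHS]EFinM.
  rewrite lee_pmul2l// ?lte_fin ?powR_gt0//.
  move=> /le_trans; apply.
  rewrite lee_fin natrX exprS invfM mulrA divff// mul1r -exprVn.
  by rewrite -[leRHS](powRr1 (ltW q0)) ger_powR.
(* Borel-Cantelli: the points lying in infinitely many F n form a null set, and any other point has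
   steps eventually at most 2^-n. *)
exists (lim_sup_set F); split.
- by apply: bigcap_measurable => // n _; apply: bigcup_measurable.
- apply: lim_sup_set_cvg0 => //.
  apply: le_lt_trans (ltry 2).
  apply: le_trans (epsilon_trick0 xpredT (ler0n R 2)).
  exact: lee_nneseries.
move=> x /=; apply: contra_notP => xF.
have [m xm] : exists m, forall n, (m <= n)%N -> ~ F n x.
  apply: contrapT => /forallNP h; apply: xF => m _.
  by have /existsNP[n /not_implyP[mn /contrapT Fx]] := h m; exists n.
apply: (@geometric_steps_cvg _ _ m) => n /xm /negP.
by rewrite -leNgt.
Qed.

(* The subtracted term is what lets the induction on k close. *)
Lemma fast_cauchy_trunc_moment_le p v : 1 <= p ->
  (forall n, measurable_fun setT (v n)) ->
  (forall n,
    (trunc_moment mu p (v n.+1 \- v n)%R <= ((4^-1 ^+ n) `^ p)%:E)%E) ->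
  forall n k, (trunc_moment mu p (v (n + k)%N \- v n)%R `^ p^-1 <=
    (2 * (4^-1 ^+ n - 4^-1 ^+ (n + k)))%:E)%E.
Proof.
move=> p1 mv vp n k; have p0 : 0 < p by rewrite (lt_le_trans ltr01).
have pV0 : 0 <= p^-1 by rewrite invr_ge0 ltW.
have mvv i j : measurable_fun setT (v i \- v j) by exact: measurable_funB.
elim: k => [|k IHk].
  rewrite addn0 subrr mulr0 (_ : trunc_moment _ _ _ = 0%E).
    by rewrite poweR0r// invr_eq0 gt_eqF.
  rewrite trunc_moment.unlock integral0_eq// => x _ /=.
  by rewrite subrr normr0 minEle ler01 powR0// gt_eqF.
have tri : \forall x \ae mu, `|(v (n + k.+1)%N \- v n) x| <=
    `|(v (n + k).+1 \- v (n + k)%N) x| + `|(v (n + k)%N \- v n) x|.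
  apply: nearW => x /=; rewrite addnS.
  by rewrite (le_trans _ (ler_normD _ _))// addrA subrK.
apply: le_trans (trunc_moment_triangle p1 (mvv _ _) (mvv _ _) (mvv _ _) tri) _.
have q0 : 0 <= 4^-1 ^+ (n + k) :> R by rewrite exprn_ge0// invr_ge0.
apply: (@le_trans _ _ ((4^-1 ^+ (n + k))%:E +
    (2 * (4^-1 ^+ n - 4^-1 ^+ (n + k)))%:E)%E).
  apply: leeD => //.
  by rewrite poweRV_le ?trunc_moment_ge0.
rewrite -EFinD lee_fin addnS [in leRHS]exprS; lra.
Qed.

(** The bound on v (n + k) - v n is uniform in k; with n fixed, Fatou's lemma carries it to the a.e.
    limit f as k grows. *)
Lemma fast_cauchy_cvg p v : 1 <= p -> (forall n, measurable_fun setT (v n)) ->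
  (forall n,
    (trunc_moment mu p (v n.+1 \- v n)%R <= ((4^-1 ^+ n) `^ p)%:E)%E) ->
  exists2 f, measurable_fun setT f &
    forall n, (trunc_moment mu p (v n \- f)%R `^ p^-1 <= (2 * 4^-1 ^+ n)%:E)%E.
Proof.
move=> p1 mv vp; have p0 : 0 < p by rewrite (lt_le_trans ltr01).
have [f [N [mf mN N0 vf]]] :=
  ae_cvg_measurable_lim mv (fast_cauchy_ae_cvg p1 mv vp).
exists f => // n.
have q0 k : 0 <= 4^-1 ^+ k :> R by rewrite exprn_ge0// invr_ge0.
have c0 : 0 <= 2 * 4^-1 ^+ n :> R by rewrite mulr_ge0.
have vnk k : (trunc_moment mu p (v (n + k)%N \- v n)%R <=
    ((2 * 4^-1 ^+ n) `^ p)%:E)%E.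
  rewrite -poweRV_le ?trunc_moment_ge0//.
  apply: le_trans (fast_cauchy_trunc_moment_le p1 mv vp n k) _.
  by rewrite lee_fin ler_pM2l// gerBl.
rewrite poweRV_le ?trunc_moment_ge0// trunc_moment.unlock.
apply: (@fatou_cvg (fun k x =>
  (Num.min `|(v (n + k)%N x - v n x)%R| 1 `^ p)%:E) _ N) => //.
- move=> k; apply: (@measurable_powR_trunc _ _ _ _ (v (n + k)%N \- v n)).
  exact: measurable_funB.
- apply: (@measurable_powR_trunc _ _ _ _ (v n \- f)).
  exact: measurable_funB.
- move=> x /vf vfx; apply: cvg_EFin; first exact: nearW.
  rewrite /=; apply: cvg_powR_nneg => //.
  have trunc_continuous : continuous
      ((fun y : R^o => `|y - v n x| : R^o) \min (fun=> 1 : R^o)).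
    move=> y; apply: continuous_min; last exact: cvg_cst.
    by apply: cvg_norm; apply: cvgB; [exact: cvg_id|exact: cvg_cst].
  have vnx : (v (n + k)%N x : R^o) @[k --> \oo] --> (f x : R^o).
    under eq_fun do rewrite addnC.
    by move: vfx; rewrite -(cvg_shiftn n).
  rewrite distrC; exact: cvg_comp vnx (trunc_continuous (f x)).
- by move=> k; have := vnk k; rewrite trunc_moment.unlock.
Qed.

End fast_cauchy.

(** * The F-norm on Lambda_p and its convergence *)

Section alpha_fnorm.
Context d (T : measurableType d) (R : realType).
Variables (mu : {measure set T -> \bar R}) (p : R).
Hypothesis p1 : 1 <= p.

Let p0 : 0 < p. Proof. exact: lt_le_trans p1. Qed.
Let p0' : 0 <= p. Proof. exact: ltW. Qed.

Lemma alpha_cvgP (v : (T -> R)^nat) (f : T -> R) :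
  (forall n, measurable_fun setT (v n)) -> measurable_fun setT f ->
  alpha_cvg mu p v f <->
  trunc_moment mu p (v n \- f) @[n --> \oo] --> 0%E.
Proof.
move=> mv mf.
have mvf n : measurable_fun setT (v n \- f) by exact: measurable_funB.
have I0 (A : set T) n : (0 <= \int[mu]_(x in A) (`|v n x - f x| `^ p)%:E)%E.
  by apply: integral_ge0 => x _; rewrite lee_fin powR_ge0.
have M0 n := trunc_moment_ge0 mu p (v n \- f).
split=> [[B [mB muB intB]]|vf0].
  apply: (@squeeze_cvge _ _ _ _ (fun=> 0%E) _ (fun n => mu (~` B n) +
      \int[mu]_(x in B n) (`|v n x - f x| `^ p)%:E)%E).
  - apply: nearW => n; rewrite M0/=.
    by rewrite -{2}(setCK (B n)) trunc_moment_le_setC//; exact: measurableC.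
  - exact: cvg_cst.
  - by rewrite -(adde0 0%E); apply: cvgeD.
exists (fun n => ~` [set x | 1 < `|v n x - f x|]); split.
- by move=> n; apply: measurableC; exact: measurable_gt_norm (mvf n).
- under eq_fun do rewrite setCK.
  apply: (@squeeze_cvge _ _ _ _ (fun=> 0%E) _ _ _ 0%E (cvg_cst _) vf0).
  apply: nearW => n; rewrite measure_ge0/=.
  exact: trunc_moment_markov1 (mvf n).
- apply: (@squeeze_cvge _ _ _ _ (fun=> 0%E) _ _ _ 0%E (cvg_cst _) vf0).
  apply: nearW => n; rewrite I0/=.
  have := le_integral_trunc_moment mu p0' (mvf n) (lexx 1).
  by rewrite powR1 mul1e.
Qed.

Implicit Types f g : LambdaType mu p1.

Lemma LambdaType_moment_lty f : (trunc_moment mu p f < +oo)%E.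
Proof. by apply/(Lambda_trunc_moment p1)/set_mem/Lambda_valP. Qed.

(** [fine] hides no default value: the norm is finite on [LambdaType], as [alpha_realE] records. *)
Definition alpha_real f : R := fine (alpha_norm mu p f).

Lemma alpha_realE f : (alpha_real f)%:E = (trunc_moment mu p f `^ p^-1)%E.
Proof.
rewrite fineK alpha_normE// ge0_fin_numE ?poweR_ge0//.
by rewrite poweR_lty// LambdaType_moment_lty.
Qed.

Lemma alpha_real_lt f (e : R) : 0 <= e ->
  (alpha_real f < e) = (trunc_moment mu p f < (e `^ p)%:E)%E.
Proof.
by move=> e0; rewrite -lte_fin alpha_realE poweRV_lt ?trunc_moment_ge0.
Qed.

Lemma alpha_real_ge0 f : 0 <= alpha_real f.
Proof. by rewrite -lee_fin alpha_realE poweR_ge0. Qed.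

Lemma alpha_real_gt0 f : f != 0 -> 0 < alpha_real f.
Proof.
rewrite lt_neqAle alpha_real_ge0 andbT; apply: contra_neq => /esym f0.
apply: val_inj; apply/L0P.
have := congr1 EFin f0; rewrite alpha_realE => /poweR_eq0_eq0 M0.
have := trunc_moment_eq0 p0 (measurable_L0 (f : L0 mu))
  (M0 (trunc_moment_ge0 _ _ _)).
by apply: filterS2 (L0_0E mu) => x /= ->.
Qed.

Lemma alpha_realZ_le (l : R) f : `|l| <= 1 ->
  alpha_real (l *: f) <= alpha_real f.
Proof.
move=> l1; rewrite -lee_fin !alpha_realE.
apply: gt0_ler_poweR; first by rewrite invr_ge0.
- by rewrite in_itv/= leey trunc_moment_ge0.
- by rewrite in_itv/= leey trunc_moment_ge0.
apply: le_trunc_moment => //.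
apply: filterS (L0_ZE l (f : L0 mu)) => x /= ->.
by rewrite normrM ler_piMl.
Qed.

Lemma alpha_real_cvgZ f : alpha_real (l *: f) @[l --> (0 : R)^'] --> 0.
Proof.
apply/cvgr0Pnorm_lt => e e0.
have [c c0 small] := trunc_moment_scale_small p1 (measurable_L0 (f : L0 mu))
  (LambdaType_moment_lty f) (powR_gt0 p e0).
have : \forall l \near (0 : R)^', `|l| < c.
  by apply: dnbhs0_lt.
apply: filterS => l /small lc.
rewrite (ger0_norm (alpha_real_ge0 _)) (alpha_real_lt _ (ltW e0)).
rewrite (@eq_trunc_moment _ _ _ _ _ _ (fun x => l * (f : L0 mu) x)) ?p0'//.
  exact: measurable_funM.
by apply: filterS (L0_ZE l (f : L0 mu)) => x /= ->.
Qed.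

Lemma alpha_realD_le f g : alpha_real (f + g) <= alpha_real f + alpha_real g.
Proof.
rewrite -lee_fin EFinD !alpha_realE.
apply: trunc_moment_triangle => //; try exact: measurable_L0.
apply: filterS (L0_DE (f : L0 mu) g) => x /= ->; exact: ler_normD.
Qed.

Definition alpha_fnorm : fnorm (LambdaType mu p1) :=
  FNorm alpha_real_ge0 alpha_real_gt0 alpha_realZ_le alpha_real_cvgZ
    alpha_realD_le.

Lemma alpha_fnormE f : (alpha_fnorm f)%:E = alpha_norm mu p f.
Proof. by rewrite alpha_normE -alpha_realE. Qed.

Lemma alpha_fnorm_lt f (e : R) : 0 <= e ->
  (alpha_fnorm f < e) = (trunc_moment mu p f < (e `^ p)%:E)%E.
Proof. exact: alpha_real_lt. Qed.

Lemma L0_representative (u : T -> R) : measurable_fun setT u ->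
  exists f : L0 mu, \forall x \ae mu, f x = u x.
Proof.
move=> mu_u; exists (\pi_(L0 mu) (mfun_Sub (mem_set mu_u)))%qT.
exact: L0_piE.
Qed.

(** Bridges the difference of classes, known only a.e., and the pointwise difference of
    representatives. *)
Lemma trunc_moment_subE f g :
  trunc_moment mu p (f - g : LambdaType mu p1) =
  trunc_moment mu p ((f : T -> R) \- (g : T -> R)).
Proof.
apply: eq_trunc_moment => //.
by apply: filterS (L0_BE (f : L0 mu) g) => x /= ->.
Qed.

Lemma alpha_fast_cauchy_cvg (u : nat -> LambdaType mu p1) :
  (forall n, alpha_fnorm (u n.+1 - u n) < 4^-1 ^+ n) ->
  exists f : LambdaType mu p1, alpha_fnorm (u n - f) @[n --> \oo] --> 0.
Proof.
move=> ufast; pose v n : T -> R := u n.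
have q0 n : 0 <= 4^-1 ^+ n :> R by rewrite exprn_ge0// invr_ge0.
have mv n : measurable_fun setT (v n) by exact: measurable_L0.
have vp n : (trunc_moment mu p (v n.+1 \- v n)%R <= ((4^-1 ^+ n) `^ p)%:E)%E.
  by rewrite -trunc_moment_subE ltW// -alpha_fnorm_lt.
have [w mw vw] := fast_cauchy_cvg p1 mv vp.
have [f fw] := L0_representative mw.
have vf n : trunc_moment mu p (v n \- f) = trunc_moment mu p (v n \- w).
  apply: eq_trunc_moment => //.
    exact: measurable_funB.
  by apply: filterS fw => x /= ->.
(* The limit stays in Lambda_p because |f| <= |v 0| + |v 0 - w| a.e. and both terms have finite
   moment. *)
have fL : Lambda mu p f.
  apply/(Lambda_trunc_moment p1).
  have pV0 : p^-1 != 0 by rewrite invr_eq0 gt_eqF.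
  apply: (lty_poweRy pV0).
  have tri : \forall x \ae mu, `|f x| <= `|v 0%N x| + `|(v 0%N \- w) x|.
    apply: filterS fw => x /= ->; rewrite distrC.
    by rewrite (le_trans _ (ler_normD _ _))// addrC subrK.
  apply: le_lt_trans (trunc_moment_triangle p1 _ _ _ tri) _ => //.
  - exact: measurable_funB.
  apply: lte_add_pinfty; last exact: le_lt_trans (vw 0%N) (ltry _).
  by rewrite -alpha_realE ltry.
exists (LambdaSub p1 (mem_set fL)).
apply: (@squeeze_cvgr _ _ _ _ (fun=> 0) (fun n => 2 * 4^-1 ^+ n)).
- apply: nearW => n; rewrite alpha_real_ge0/=.
  by rewrite -lee_fin alpha_realE trunc_moment_subE vf.
- exact: cvg_cst.
- rewrite -(mulr0 2); apply: cvgMr; apply: cvg_expr.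
  by rewrite ger0_norm ?invr_ge0// invf_lt1// ltr1n.
Qed.

Lemma alpha_Fspace : Fspace alpha_fnorm.
Proof.
split.
- exact: fnormed_add_continuous.
- exact: fnormed_scale_continuous.
- by move=> f g h; rewrite !fnormed_mdistE opprD addrACA subrr addr0.
- exact: fnormed_complete alpha_fast_cauchy_cvg.
Qed.

(** Radius e in the metric corresponds to level e^p of the moment, so the two null-sequence
    conditions agree. *)
Lemma alpha_fnorm_cvgP (f_ : nat -> LambdaType mu p1) f :
  ((f_ : nat -> fnormed alpha_fnorm) @ \oo --> (f : fnormed alpha_fnorm)) <->
  alpha_cvg mu p (fun n => f_ n : T -> R) (f : T -> R).
Proof.
rewrite alpha_cvgP; [|by move=> n; exact: measurable_L0|exact: measurable_L0].
rewrite cvge0P; last by move=> n; exact: trunc_moment_ge0.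
split=> [/metricType_numDomainType.cvgrPdist_lt fcvg e e0|fcvg].
  have e10 : 0 < e `^ p^-1 by rewrite powR_gt0.
  apply: filterS (fcvg _ e10) => n.
  rewrite metric_sym fnormed_mdistE (alpha_fnorm_lt _ (ltW e10)).
  by rewrite trunc_moment_subE -powRrM mulVf ?gt_eqF// powRr1// ltW.
apply/metricType_numDomainType.cvgrPdist_lt => e e0.
apply: filterS (fcvg _ (powR_gt0 p e0)) => n.
rewrite metric_sym fnormed_mdistE (alpha_fnorm_lt _ (ltW e0)).
by rewrite trunc_moment_subE.
Qed.

End alpha_fnorm.

(** * Comparison of the topologies for finite measure *)

Lemma metric_openP (R : realType) (M : metricType R) (U : set M) :
  open U <->
  forall f, U f -> exists2 e : R, 0 < e & forall g, mdist f g < e -> U g.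
Proof.
rewrite openE; split=> UU f /UU.
  by move=> /metricType_numDomainType.nbhs_mdistP[e /= e0 fe]; exists e.
by move=> [e e0 fe]; apply/metricType_numDomainType.nbhs_mdistP; exists e.
Qed.

Section finite_measure.
Context d (T : measurableType d) (R : realType).
Variable mu : {measure set T -> \bar R}.
Hypothesis mu_fin : (mu [set: T] < +oo)%E.
Implicit Types (p : R) (h : T -> R) (f g : L0 mu).

(** With M = mu(X), a level s < 1 with mu(|h| > s) + s < e / (1 + M) gives a moment at most mu(|h| >
    s) + s M, hence below e. *)
Lemma trunc_moment_meas_norm p (e : R) : 1 <= p -> 0 < e ->
  exists2 r : R, 0 < r & forall h, measurable_fun setT h ->
    meas_norm mu h < r -> (trunc_moment mu p h < e%:E)%E.
Proof.
move=> p1 e0; have p0 : 0 <= p by rewrite (le_trans ler01).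
set M := fine (mu [set: T]).
have ME : mu [set: T] = M%:E by rewrite fineK// ge0_fin_numE.
have M0 : 0 <= M by rewrite fine_ge0.
have M1 : 0 < 1 + M by rewrite ltr_wpDr.
(* Staying below 1 removes the cap in [meas_norm] and forces s < 1, so that s^p <= s. *)
exists (Num.min 1 (e / (1 + M))); first by rewrite lt_min ltr01 divr_gt0.
move=> h mh; rewrite lt_min => /andP[h1 he].
have hinf : (meas_inf mu h < (e / (1 + M))%:E)%E.
  move: he h1; rewrite -!lte_fin meas_normE !gt_min ltxx orbF.
  move=> /orP[//|h1'] h1; exact: lt_trans h1 h1'.
have hinf1 : (meas_inf mu h < 1%:E)%E.
  by move: h1; rewrite -lte_fin meas_normE gt_min ltxx orbF.
have [|s s0] := @meas_inf_lt _ _ _ mu h (mine 1%:E (e / (1 + M))%:E)%E.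
  by rewrite lt_min hinf1.
rewrite lt_min => /andP[s1 se].
have mA := measurable_gt_norm s mh.
set m := mu _ in s1 se.
have m0 : (0 <= m)%E by exact: measure_ge0.
have mfin : m = (fine m)%:E.
  rewrite fineK// ge0_fin_numE//; apply: le_lt_trans mu_fin.
  by apply: le_measure; rewrite ?inE.
apply: le_lt_trans (trunc_moment_le_setC mu p0 mh mA) _.
have int_le : (\int[mu]_(x in ~` [set x | (s < `|h x|)%R]) (`|h x| `^ p)%:E <=
    (s * M)%:E)%E.
  rewrite EFinM -ME.
  apply: (@le_trans _ _
    (s%:E * mu (~` [set x | (s < `|h x|)%R]))%E); last first.
    rewrite lee_pmul2l//; apply: le_measure; rewrite ?inE//; exact: measurableC.
  rewrite -integral_cst; last exact: measurableC.
  apply: ge0_le_integral => //.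
  - exact: measurableC.
  - by apply: measurable_funTS; exact: measurable_powR_norm.
  move=> x /= /negP; rewrite -leNgt lee_fin => hs.
  apply: (@le_trans _ _ (s `^ p)); first by rewrite ge0_ler_powR ?nnegrE// ltW.
  rewrite -[leRHS](powRr1 (ltW s0)) ger_powR// s0/=.
  rewrite -lee_fin; apply: le_trans (ltW s1); by rewrite leeDr.
apply: (le_lt_trans (leeD2l _ int_le)).
rewrite -/m mfin -EFinD lte_fin.
move: se; rewrite mfin -EFinD lte_fin ltr_pdivlMr//; apply: le_lt_trans.
have : 0 <= fine m by rewrite fine_ge0.
nra.
Qed.

(** Markov at s = min(1, e / 2): a moment below s^p s gives mu(|h| > s) < s, and 2 s <= e. *)
Lemma meas_norm_trunc_moment p (e : R) : 0 <= p -> 0 < e ->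
  exists2 r : R, 0 < r & forall h, measurable_fun setT h ->
    (trunc_moment mu p h < r%:E)%E -> meas_norm mu h < e.
Proof.
move=> p0 e0; pose s := Num.min 1 (e / 2).
have s0 : 0 < s by rewrite lt_min ltr01 divr_gt0.
have s1 : 0 < s <= 1 by rewrite s0 ge_min lexx.
have sp : 0 < s `^ p by rewrite powR_gt0.
exists (s `^ p * s) => [|h mh hs]; first by rewrite mulr_gt0.
have := le_lt_trans (trunc_moment_markov mu p0 mh s1) hs.
rewrite EFinM lte_pmul2l// ?lte_fin// => hms.
rewrite -lte_fin meas_normE gt_min; apply/orP; left.
apply: le_lt_trans (meas_inf_le mu h s0) _.
apply: (@lt_le_trans _ _ (s%:E + s%:E)%E); first by rewrite lteD2rE.
by rewrite -EFinD lee_fin [leRHS]splitr lerD// /s ge_min lexx orbT.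
Qed.

(** Taking E to be the whole space in [trunc_moment_le_setC] bounds every moment by mu(X). *)
Lemma Lambda_setT p : 1 <= p -> Lambda mu p = [set: L0 mu].
Proof.
move=> p1; have p0 : 0 <= p by rewrite (le_trans ler01).
apply/seteqP; split=> // f _; apply/(Lambda_trunc_moment p1).
apply: le_lt_trans (trunc_moment_le_setC mu p0 (measurable_L0 f) measurableT) _.
by rewrite setCT integral_set0 adde0.
Qed.

(** By [Lambda_setT] every class lifts to [LambdaType], so balls of the two metrics with the same
    centre can be nested in both directions. *)
Lemma open_alpha_measure p (p1 : 1 <= p) (U : set (L0 mu)) :
  open ((@Lambda_val _ _ _ mu p p1) @^-1` U :
    set (fnormed (alpha_fnorm mu p1))) <->
  open (U : set (L0_measure mu)).
Proof.
have p0 : 0 < p by rewrite (lt_le_trans ltr01).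
rewrite !metric_openP; split=> UU f Uf.
  have fL : Lambda mu p f by rewrite Lambda_setT.
  have [e e0 fe] := UU (LambdaSub p1 (mem_set fL)) Uf.
  have [r r0 small] := trunc_moment_meas_norm p1 (powR_gt0 p e0).
  exists r => // g fg; have gL : Lambda mu p g by rewrite Lambda_setT.
  apply: (fe (LambdaSub p1 (mem_set gL))).
  rewrite fnormed_mdistE (alpha_fnorm_lt _ (ltW e0)).
  exact: small (measurable_L0 _) fg.
have [e e0 fe] := UU _ Uf.
have [r r0 small] := meas_norm_trunc_moment (ltW p0) e0.
exists (r `^ p^-1) => [|g fg]; first by rewrite powR_gt0.
apply: fe; apply: small; first exact: measurable_L0.
move: fg; rewrite fnormed_mdistE (alpha_fnorm_lt _ (powR_ge0 _ _)).
by rewrite -powRrM mulVf ?gt_eqF// powRr1// ltW.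
Qed.

(** The F-seminorms of [L0_local]; on the whole space this is the truncated moment of exponent 1. *)
Definition local_moment (F : set T) h : \bar R :=
  (\int[mu]_(x in F) (Num.min `|h x| 1)%:E)%E.

Lemma measurable_trunc h : measurable_fun setT h ->
  measurable_fun setT (fun x => (Num.min `|h x| 1)%:E).
Proof.
move=> mh; apply/measurable_EFinP/measurable_minr => //.
exact: measurableT_comp.
Qed.

Lemma local_moment_setT h : local_moment setT h = trunc_moment mu 1 h.
Proof.
rewrite trunc_moment.unlock; apply: eq_integral => x _.
by rewrite powRr1 ?trunc_ge0.
Qed.

Lemma local_moment_le (F : set T) h : measurable F -> measurable_fun setT h ->
  (local_moment F h <= trunc_moment mu 1 h)%E.
Proof.
move=> mF mh; rewrite -local_moment_setT; apply: ge0_subset_integral => //.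
exact: measurable_trunc.
Qed.

Lemma local_moment_triangle (F : set T) h h1 h2 : measurable F ->
  measurable_fun setT h -> measurable_fun setT h1 -> measurable_fun setT h2 ->
  (\forall x \ae mu, `|h x| <= `|h1 x| + `|h2 x|) ->
  (local_moment F h <= local_moment F h1 + local_moment F h2)%E.
Proof.
move=> mF mh mh1 mh2 hh.
have mt (k : T -> R) : measurable_fun setT k ->
    measurable_fun F (fun x => (Num.min `|k x| 1)%:E).
  by move=> mk; apply: measurable_funTS; exact: measurable_trunc.
have t0 (k : T -> R) x : F x -> (0 <= (Num.min `|k x| 1)%:E)%E.
  by move=> _; rewrite lee_fin trunc_ge0.
rewrite /local_moment.
rewrite -(ge0_integralD _ mF (t0 h1) (mt _ mh1) (t0 h2) (mt _ mh2)).
apply: ae_ge0_le_integral; first exact: mF.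
- exact: t0.
- exact: mt.
- by move=> x Fx; rewrite adde_ge0 ?t0.
- by apply: emeasurable_funD; exact: mt.
apply: filterS hh => x hx _; rewrite -EFinD lee_fin.
exact: trunc_le_add.
Qed.

Lemma trunc_moment_subC p f g : 0 <= p ->
  trunc_moment mu p (f - g : L0 mu) = trunc_moment mu p (g - f : L0 mu).
Proof.
move=> p0; apply: eq_trunc_moment => //; try exact: measurable_L0.
by apply: filterS2 (L0_BE f g) (L0_BE g f) => x -> ->; rewrite distrC.
Qed.

Lemma trunc_moment0 p : 0 < p -> trunc_moment mu p (0 : L0 mu) = 0%E.
Proof.
move=> p0; rewrite (@eq_trunc_moment _ _ _ _ _ _ (fun=> 0)) ?(ltW p0)//.
  rewrite trunc_moment.unlock integral0_eq// => x _.
  by rewrite normr0 minEle ler01 powR0// gt_eqF.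
by apply: filterS (L0_0E mu) => x ->.
Qed.

Definition local_ball (F : set T) (c : L0 mu) (r : R) : set (L0 mu) :=
  [set g : L0 mu | (local_moment F (g - c : L0 mu)%R < r%:E)%E].

(** A subbasic set is a one-member intersection, and a union over a single such intersection. *)
Lemma local_ball_local_open (F : set T) (c : L0 mu) (r : R) :
  measurable F -> (mu F < +oo)%E -> 0 < r ->
  open (local_ball F c r : set (L0_local mu)).
Proof.
move=> mF muF r0; exists [set local_ball F c r]; last by rewrite bigcup_set1.
move=> _ ->.
pose D := [set i : set T * L0 mu * R |
  [/\ measurable i.1.1, (mu i.1.1 < +oo)%E & 0 < i.2]].
pose b (i : set T * L0 mu * R) := local_ball i.1.1 i.1.2 i.2.
by apply: (@finI_from1 _ _ D b (F, c, r)); split.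
Qed.

Lemma local_ball_measure_open (F : set T) (c : L0 mu) (r : R) :
  measurable F -> open (local_ball F c r : set (L0_measure mu)).
Proof.
move=> mF; apply/metric_openP => f fr.
have K0 : (0 <= local_moment F (f - c : L0 mu)%R)%E.
  by apply: integral_ge0 => x _; rewrite lee_fin trunc_ge0.
have KE : local_moment F (f - c : L0 mu)%R =
    (fine (local_moment F (f - c : L0 mu)%R))%:E.
  by rewrite fineK// ge0_fin_numE// (lt_trans fr)// ltry.
(* The centre c need not be f: the slack left at f is the room allowed for the exponent-1 moment of
   g - f. *)
have e0 : 0 < r - fine (local_moment F (f - c : L0 mu)%R).
  by rewrite subr_gt0 -lte_fin -KE.
have [s s0 small] := trunc_moment_meas_norm (lexx 1) e0.
exists s => // g /(small _ (measurable_L0 _)) fg.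
have tri : \forall x \ae mu, `|(g - c : L0 mu) x| <=
    `|(g - f : L0 mu) x| + `|(f - c : L0 mu) x|.
  apply: filterS3 (L0_BE g c) (L0_BE g f) (L0_BE f c) => x -> -> ->.
  by rewrite (le_trans _ (ler_normD _ _))// addrA subrK.
apply: le_lt_trans (local_moment_triangle mF (measurable_L0 _)
  (measurable_L0 _) (measurable_L0 _) tri) _.
rewrite KE -lteBrDr//.
apply: le_lt_trans (local_moment_le mF (measurable_L0 _)) _.
by rewrite trunc_moment_subC.
Qed.

Lemma open_measure_local (U : set (L0 mu)) :
  open (U : set (L0_measure mu)) <-> open (U : set (L0_local mu)).
Proof.
split=> [/metric_openP UU|[C CU <-]].
  rewrite openE => f /UU[e e0 fe].
  have [r r0 small] := meas_norm_trunc_moment ler01 e0.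
  (* As mu(X) is finite, F may be the whole space, and the resulting subbasic ball lies inside the
     metric ball. *)
  rewrite /interior nbhsE /=; exists (local_ball setT f r).
    split; first exact: local_ball_local_open.
    by rewrite /local_ball /= local_moment_setT subrr trunc_moment0// lte_fin.
  move=> g; rewrite /local_ball /= local_moment_setT => gf.
  apply: fe; apply: (small _ (measurable_L0 _)).
  by rewrite (trunc_moment_subC f g ler01).
(* An open set of [L0_local] is a union of finite intersections of subbasic sets, so openness of
   each [local_ball] in the metric suffices. *)
apply: bigcup_open => A /CU [D' D'sub <-].
rewrite bigcap_fset big_seq.
apply: (big_ind (fun A : set (L0_measure mu) => open A)) => [||i iD'].
- exact: openT.
- exact: openI.
have /set_mem /= [mF _ _] := D'sub _ iD'.
exact: (@local_ball_measure_open i.1.1 i.1.2 i.2 mF).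
Qed.

End finite_measure.

Theorem theorem1p1 (d : measure_display) (T : measurableType d) (R : realType)
    (mu : {measure set T -> \bar R}) (p : R) (p1 : 1 <= p) :
  exists N : fnorm (LambdaType mu p1),
    [/\ forall f : LambdaType mu p1, (N f)%:E = alpha_norm mu p f,
        Fspace N,
        forall (f_ : nat -> LambdaType mu p1) (f : LambdaType mu p1),
          ((f_ : nat -> fnormed N) @ \oo --> (f : fnormed N)) <->
          alpha_cvg mu p (fun n => f_ n : T -> R) (f : T -> R) &
        (mu [set: T] < +oo)%E ->
          [/\ Lambda mu p = [set: L0 mu],
              forall U : set (L0 mu),
                open ((@Lambda_val _ _ _ mu p p1) @^-1` U : set (fnormed N)) <->
                open (U : set (L0_measure mu)) &
              forall U : set (L0 mu),
                open (U : set (L0_measure mu)) <->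
                open (U : set (L0_local mu))]].
Proof.
exists (alpha_fnorm mu p1); split.
- exact: alpha_fnormE.
- exact: alpha_Fspace.
- exact: alpha_fnorm_cvgP.
move=> mu_fin; split.
- exact: Lambda_setT.
- exact: open_alpha_measure.
- exact: open_measure_local.
Qed.
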